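(* Let $\alpha,\alpha_0,\alpha_1,\tau\in C^{\log}_{\mathrm{loc}}$ with $\tau^->0$, and let $p,q_0,q_1\in\mathcal P_0^{\log}$ with $p^+,q_0^+,q_1^+<\infty$. (i) If $q_0\le q_1$, then $\mathfrak F^{\alpha(\cdot),\tau(\cdot)}_{p(\cdot),q_0(\cdot)}\hookrightarrow \mathfrak F^{\alpha(\cdot),\tau(\cdot)}_{p(\cdot),q_1(\cdot)}$. (ii) If $(\alpha_0-\alpha_1)^->0$, then $\mathfrak F^{\alpha_0(\cdot),\tau(\cdot)}_{p(\cdot),q_0(\cdot)}\hookrightarrow \mathfrak F^{\alpha_1(\cdot),\tau(\cdot)}_{p(\cdot),q_1(\cdot)}$.
   Context: $A_1\hookrightarrow A_2$ for quasi-normed spaces means $A_1\subset A_2$ and there is $c>0$ with $\|f\|_{A_2}\le c\|f\|_{A_1}$ for all $f\in A_1$. Exponents. $\mathcal P_0$ is the set of measurable functions $p$ on $\mathbb R^n$ with range in $[c,\infty)$ for some $c>0$. For a measurable function $g$, $g^-$ and $g^+$ denote its essential infimum and essential supremum. $g\in C^{\log}_{\mathrm{loc}}$ means that $g:\mathbb R^n\to\mathbb R$ and there is a constant $c_{\log}(g)>0$ with $|g(x)-g(y)|\le c_{\log}(g)/\log(e+1/|x-y|)$ for all $x,y\in\mathbb R^n$; $g\in C^{\log}$ means that in addition there are $g_\infty\in\mathbb R$ and $c_{\log}>0$ with $|g(x)-g_\infty|\le c_{\log}/\log(e+|x|)$ for all $x$. $\mathcal P_0^{\log}=\{p\in\mathcal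 P_0:1/p\in C^{\log}\}$. Norms. $\|f\|_{p(\cdot)}=\inf\{\mu>0:\int_{\mathbb R^n}|f(x)/\mu|^{p(x)}dx\le1\}$, and $\|(f_v)_v\|_{L^{p(\cdot)}(\ell^{q(\cdot)})}=\big\|\,\|(f_v(x))_v\|_{\ell^{q(x)}}\big\|_{p(\cdot)}$. Dyadic cubes. $Q_{v,m}=\{x: m_i\le 2^vx_i<m_i+1,\ i=1,\dots,n\}$ for $v\in\mathbb Z$, $m\in\mathbb Z^n$; $\mathcal Q$ is the set of all of them; for a cube $P$ of side length $l(P)$, $v_P=-\log_2 l(P)$ and $v_P^+=\max(v_P,0)$. Function space. Fix $\Phi,\varphi\in\mathcal S(\mathbb R^n)$ such that, for some $c>0$ ($\mathcal F$ is the Fourier transform), $\operatorname{supp}\mathcal F\Phi\subset\overline{B(0,2)}$ and $|\mathcal F\Phi(\xi)|\ge c$ if $|\xi|\le 5/3$, and $\operatorname{supp}\mathcal F\varphi\subset\overline{B(0,2)}\setminus B(0,1/2)$ and $|\mathcal F\varphi(\xi)|\ge c$ if $3/5\le|\xi|\le5/3$. Put $\varphi_v=2^{vn}\varphi(2^v\cdot)$ for $v\ge1$, with $\varphi_0$ replaced by $\Phi$. Then $\mathfrak F^{\alpha(\cdot),\tau(\cdot)}_{p(\cdot),q(\cdot)}$ is the set of all $f\in\mathcal S'(\mathbb R^n)$ with $$\|f\|_{\mathfrak F^{\alpha(\cdot),\tau(\cdot)}_{p(\cdot),q(\cdot)}}=\sup_{P\in\mathcal Q}\Big\|\Big(\frac{2^{v\alpha(\cdot)}\varphi_v*f}{|P|^{\tau(\cdot)}}\chi_P\Big)_{v\ge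 v_P^+}\Big\|_{L^{p(\cdot)}(\ell^{q(\cdot)})}<\infty .$$ *)

(* Defs.v *)
From HB Require Import structures.
From mathcomp Require Import all_boot all_order all_algebra.
From mathcomp Require Import all_classical all_reals all_analysis.
From mathcomp Require Import ess_sup_inf complex.

Set Implicit Arguments.
Unset Strict Implicit.
Unset Printing Implicit Defensive.

Import Order.TTheory GRing.Theory Num.Theory.
Import numFieldNormedType.Exports.
Import ComplexField.

Local Open Scope classical_set_scope.
Local Open Scope ring_scope.

Definition measure_row_display : measure_display.
Proof. exact: default_measure_display. Qed.

(* The sigma-algebra of R^n generated by the coordinates, i.e. the Borel one. *)
Section measurable_row.
Variables (R : realType) (n : nat).

Let coors : 'I_n -> 'rV[R]_n -> measurableTypeR R := fun i x => x 0 i.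

Let row_set0 : g_sigma_preimage coors set0.
Proof. exact: sigma_algebra0. Qed.

Let row_setC A : g_sigma_preimage coors A -> g_sigma_preimage coors (~` A).
Proof. exact: sigma_algebraC. Qed.

Let row_bigcup (F : _^nat) : (forall i, g_sigma_preimage coors (F i)) ->
  g_sigma_preimage coors (\bigcup_i (F i)).
Proof. exact: sigma_algebra_bigcup. Qed.

HB.instance Definition _ := @isMeasurable.Build measure_row_display
  'rV[R]_n (g_sigma_preimage coors) row_set0 row_setC row_bigcup.

End measurable_row.

Lemma measurable_coord (R : realType) n (i : 'I_n) :
  measurable_fun [set: 'rV[R]_n] (fun x => x 0 i : measurableTypeR R).
Proof.
move=> _ Y mY; rewrite setTI; apply: sub_sigma_algebra => /=.
rewrite -bigcup_seq/=; exists i => /=; first by rewrite mem_index_enum.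
by exists Y => //; rewrite setTI.
Qed.

Lemma measurable_fun_row d (T : measurableType d) (R : realType) n
    (f : T -> 'rV[R]_n) :
  (forall i, measurable_fun [set: T] (fun t => f t 0 i : measurableTypeR R)) ->
  measurable_fun [set: T] f.
Proof.
move=> mf.
have sub : g_sigma_preimage
    (fun (i : 'I_n) t => f t 0 i : measurableTypeR R) `<=` measurable.
  apply: smallest_sub; first exact: sigma_algebra_measurable.
  case: n => [|n] in f mf *; first by rewrite big_ord0.
  rewrite -bigcup_mkord_ord; apply: bigcup_sub => i Ii.
  by move=> A [B mB <-]; exact: mf.
move=> _ A mA; apply: sub.
have := @g_sigma_preimage_comp _ (measurableTypeR R) n 'rV[R]_n
  (fun i x => x 0 i) T f.
rewrite /comp => ->.
by exists A.
Qed.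

Section lebesgue_measure_row.
Variable R : realType.

Definition row_cons n (tx : measurableTypeR R * 'rV[R]_n) : 'rV[R]_n.+1 :=
  \row_i oapp (fun j => tx.2 0 j) tx.1 (unlift ord0 i).

Definition row_uncons n (x : 'rV[R]_n.+1) : measurableTypeR R * 'rV[R]_n :=
  (x 0 ord0, \row_j x 0 (lift ord0 j)).

Lemma row_consK n : cancel (@row_cons n) (@row_uncons n).
Proof.
move=> [t x]; rewrite /row_cons /row_uncons; congr (_, _).
  by rewrite mxE unlift_none.
by apply/rowP => j; rewrite !mxE liftK.
Qed.

Lemma measurable_row_cons n : measurable_fun setT (@row_cons n).
Proof.
apply: measurable_fun_row => i.
rewrite (_ : (fun _ => _) = fun tx : measurableTypeR R * 'rV[R]_n =>
    oapp (fun j => tx.2 0 j) tx.1 (unlift ord0 i)); last first.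
  by apply/funext => tx; rewrite mxE.
case: unliftP => [j _|_] /=; last exact: measurable_fst.
exact: (measurableT_comp (measurable_coord j) measurable_snd).
Qed.

Lemma measurable_row_uncons n : measurable_fun setT (@row_uncons n).
Proof.
apply/measurable_fun_pairP; split; first exact: measurable_coord.
apply: measurable_fun_row => j.
rewrite (_ : (fun _ => _) =
    (fun x : 'rV[R]_n.+1 => x 0 (lift ord0 j) : measurableTypeR R)).
  exact: measurable_coord.
by apply/funext => x; rewrite /= mxE.
Qed.

Section step.
Variables (n : nat) (m : {sigma_finite_measure set 'rV[R]_n -> \bar R}).

Definition lebesgue_step : set 'rV[R]_n.+1 -> \bar R :=
  pushforward (@lebesgue_measure R \x m)%E (@row_cons n).

Let mcons := @measurable_row_cons n.

Let step0 : lebesgue_step set0 = 0%E.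
Proof. by rewrite /lebesgue_step /pushforward preimage_set0 measure0. Qed.

Let step_ge0 A : (0 <= lebesgue_step A)%E.
Proof. exact: measure_ge0. Qed.

Let step_sigma_additive : semi_sigma_additive lebesgue_step.
Proof. exact: measure_semi_sigma_additive. Qed.

HB.instance Definition _ := isMeasure.Build _ _ _ lebesgue_step
  step0 step_ge0 step_sigma_additive.

Let step_sigma_finite : sigma_finite setT lebesgue_step.
Proof.
have /sigma_finiteP[F [TF ndF Foo]] := sigma_finiteT (@lebesgue_measure R).
have /sigma_finiteP[G [TG ndG Goo]] := sigma_finiteT m.
exists (fun k => @row_uncons n @^-1` (F k `*` G k)).
  apply/esym; rewrite -subTset => x _.
  have [i _ Fi] : (\bigcup_i F i) (row_uncons x).1 by rewrite -TF.
  have [j _ Gj] : (\bigcup_i G i) (row_uncons x).2 by rewrite -TG.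
  exists (maxn i j) => //; split.
  - by move: Fi; exact/subsetPset/ndF/leq_maxl.
  - by move: Gj; exact/subsetPset/ndG/leq_maxr.
move=> k; have [mF Fk] := Foo k; have [mG Gk] := Goo k; split.
  rewrite -[X in measurable X]setTI.
  by apply: measurable_row_uncons => //; exact: measurableX.
rewrite /lebesgue_step /pushforward -comp_preimage.
rewrite (_ : _ \o _ = id) ?preimage_id; last first.
  by apply/funext => tx; exact: row_consK.
by rewrite product_measure1E// lte_mul_pinfty// ge0_fin_numE.
Qed.

HB.instance Definition _ :=
  Measure_isSigmaFinite.Build _ _ _ lebesgue_step step_sigma_finite.

End step.

(* [lebesgue_row n] is the n-fold product of the one-dimensional measure. *)
Fixpoint lebesgue_row n : {sigma_finite_measure set 'rV[R]_n -> \bar R} :=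
  match n with
  | 0 => \d_(0 : 'rV[R]_0)
  | n'.+1 => lebesgue_step (lebesgue_row n')
  end.

End lebesgue_measure_row.

Section schwartz_real.
Variables (R : realType) (n : nat).
Implicit Types (f g : 'rV[R]_n -> R) (s : seq 'I_n).

(* Multi-indices are given by the list of the successive directions of
   differentiation, so that [size s] is the order of the derivative. *)
Definition pderiv s f : 'rV[R]_n -> R :=
  foldr (fun i g x => 'D_(delta_mx 0 i) g x) f s.

Definition smooth f := forall s x, differentiable (pderiv s f) x.

(* [`|x|] is here the maximum norm, which defines the same class of functions
   as the Euclidean norm. *)
Definition rapidly_decreasing f := forall s (k : nat),
  exists M : R, forall x, (1 + `|x|) ^+ k * `|pderiv s f x| <= M.

Definition real_schwartz f := smooth f /\ rapidly_decreasing f.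

Lemma pderivD s f g : smooth f -> smooth g ->
  pderiv s (f \+ g) = pderiv s f \+ pderiv s g.
Proof.
move=> sf sg; elim: s => [//|i s IH] /=; apply/funext => x.
by rewrite IH deriveD//; apply: diff_derivable.
Qed.

Lemma pderivZ s (a : R) f : smooth f ->
  pderiv s (fun x => a * f x) = fun x => a * pderiv s f x.
Proof.
move=> sf; elim: s => [//|i s IH] /=; apply/funext => x.
by rewrite IH (@deriveZ _ _ _ (pderiv s f))//; apply: diff_derivable.
Qed.

Lemma pderiv_affine s (a : R) (b : 'rV[R]_n) f : smooth f ->
  pderiv s (fun x => f (a *: x + b)) =
  fun x => a ^+ size s * pderiv s f (a *: x + b).
Proof.
move=> sf; elim: s => [|i s IH]; first by apply/funext => x; rewrite /= mul1r.
rewrite [LHS]/= IH; apply/funext => x.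
set g := pderiv s f; set A := fun x : 'rV[R]_n => a *: x + b.
have dA : is_diff x A (fun v => a *: v).
  apply: is_diff_eq.
  by apply/funext => v /=; rewrite /cst addr0.
have dg : differentiable g (A x) by exact: sf.
have dgA : differentiable (g \o A) x by exact: differentiable_comp.
rewrite (@deriveZ _ _ _ (g \o A)); last exact: diff_derivable.
rewrite deriveE// diff_comp//= diff_val linearZ -deriveE//.
by rewrite scalerA -exprSr.
Qed.

Lemma real_schwartz0 : real_schwartz (fun=> 0).
Proof.
have p0 s : pderiv s (fun=> 0) = fun=> 0.
  elim: s => [//|i s IH] /=; apply/funext => x.
  by rewrite IH derive_cst.
split=> [s x|s k]; rewrite p0; first exact: differentiable_cst.
by exists 0 => x; rewrite normr0 mulr0.
Qed.

Lemma real_schwartzD f g :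
  real_schwartz f -> real_schwartz g -> real_schwartz (f \+ g).
Proof.
move=> [sf df] [sg dg]; split=> [s x|s k]; rewrite pderivD//.
  exact: differentiableD.
have [M fM] := df s k; have [N gN] := dg s k; exists (M + N) => x.
apply: le_trans (lerD (fM x) (gN x)).
rewrite -mulrDr ler_wpM2l ?ler_normD// exprn_ge0//.
Qed.

Lemma real_schwartzZ (a : R) f :
  real_schwartz f -> real_schwartz (fun x => a * f x).
Proof.
move=> [sf df]; split=> [s x|s k]; rewrite pderivZ//.
  exact: differentiableZ.
have [M fM] := df s k; exists (`|a| * M) => x.
by rewrite normrM mulrCA ler_wpM2l.
Qed.

Lemma real_schwartz_affine (a : R) (b : 'rV[R]_n) f : a != 0 ->
  real_schwartz f -> real_schwartz (fun x => f (a *: x + b)).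
Proof.
move=> a0 [sf df]; split=> [s x|s k]; rewrite pderiv_affine//.
  apply: differentiableZ.
  apply: (@differentiable_comp _ _ _ _ (fun x => a *: x + b) (pderiv s f)).
    by [].
  exact: sf.
have [M fM] := df s k.
pose C := 1 + `|a|^-1 * (1 + `|b|).
have C0 : 0 <= C by rewrite addr_ge0// mulr_ge0// addr_ge0.
exists (C ^+ k * `|a| ^+ size s * M) => x.
set y := a *: x + b.
have le1 : 1 + `|x| <= C * (1 + `|y|).
  have -> : x = a^-1 *: (y - b) by rewrite /y addrK scalerA mulVf// scale1r.
  rewrite normrZ normfV.
  have h : `|y - b| <= (1 + `|b|) * (1 + `|y|).
    rewrite mulrDr mulr1 mulrDl mul1r.
    apply: (le_trans (ler_normB _ _)).
    rewrite addrC lerD ?lerDr// ?lerDl// mulr_ge0//.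
  rewrite /C mulrDl mul1r lerD ?lerDl// -mulrA ler_wpM2l ?invr_ge0//.
have x0 : 0 <= 1 + `|x| by rewrite addr_ge0.
rewrite normrM normrX.
have le2 : (1 + `|x|) ^+ k <= C ^+ k * (1 + `|y|) ^+ k.
  by rewrite -exprMn lerXn2r// nnegrE// mulr_ge0// addr_ge0.
rewrite mulrCA -mulrA [leRHS]mulrCA ler_wpM2l ?exprn_ge0//.
apply: (le_trans (ler_wpM2r (normr_ge0 _) le2)).
by rewrite -mulrA ler_wpM2l ?exprn_ge0.
Qed.

End schwartz_real.

Section schwartz.
Variables (R : realType) (n : nat).

Definition schwartz : {pred 'rV[R]_n -> R[i]} := fun phi =>
  `[< real_schwartz (fun x => complex.Re (phi x)) /\
      real_schwartz (fun x => complex.Im (phi x)) >].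

Lemma schwartz_submod : submod_closed schwartz.
Proof.
split=> [|a f g /asboolP[fr fi] /asboolP[gr gi]]; apply/asboolP.
  by split; exact: real_schwartz0.
have sE x : (a *: f + g) x = a * f x + g x by [].
split.
- rewrite (_ : (fun _ => _) = (fun x => complex.Re a * complex.Re (f x)) \+
      (fun x => - complex.Im a * complex.Im (f x)) \+
      (fun x => complex.Re (g x))); last first.
    apply/funext => x /=; rewrite sE; case: {sE}a (f x) (g x) => [a1 a2] [b1 b2] [c1 c2] /=.
    by rewrite mulNr.
  by do 2?apply: real_schwartzD => //; exact: real_schwartzZ.
- rewrite (_ : (fun _ => _) = (fun x => complex.Re a * complex.Im (f x)) \+
      (fun x => complex.Im a * complex.Re (f x)) \+
      (fun x => complex.Im (g x))); last first.
    by apply/funext => x /=; rewrite sE; case: {sE}a (f x) (g x) => [a1 a2] [b1 b2] [c1 c2].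
  by do 2?apply: real_schwartzD => //; exact: real_schwartzZ.
Qed.

HB.instance Definition _ :=
  GRing.isSubmodClosed.Build R[i] ('rV[R]_n -> R[i]) schwartz schwartz_submod.

Record schwartz_space :=
  SchwartzFun { schwartz_fun :> 'rV[R]_n -> R[i]; _ : schwartz_fun \in schwartz }.

HB.instance Definition _ := [isSub for schwartz_fun].
HB.instance Definition _ := [Choice of schwartz_space by <:].
HB.instance Definition _ := [SubChoice_isSubLmodule of schwartz_space by <:].

Lemma schwartz_affine (c : R[i]) (a : R) (b : 'rV[R]_n) (phi : schwartz_space) :
  a != 0 -> (fun x => c * phi (a *: x + b)) \in schwartz.
Proof.
move=> a0; case: phi => f /= fS.
suff h : (fun x => f (a *: x + b)) \in schwartz by exact: (rpredZ c h).
case/asboolP: fS => fr fi; apply/asboolP.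
by split; [exact: (real_schwartz_affine b a0 fr)|
           exact: (real_schwartz_affine b a0 fi)].
Qed.

Lemma reflect_subproof (x : 'rV[R]_n) (phi : schwartz_space) :
  (fun y => phi (x - y)) \in schwartz.
Proof.
rewrite (_ : (fun _ => _) = (fun y => 1 * phi ((-1) *: y + x))).
  by apply: schwartz_affine; rewrite oppr_eq0 oner_eq0.
by apply/funext => y; rewrite mul1r scaleN1r addrC.
Qed.

Definition reflect (x : 'rV[R]_n) (phi : schwartz_space) :=
  SchwartzFun (reflect_subproof x phi).

Lemma dilate_subproof (v : nat) (phi : schwartz_space) :
  (fun x => ((2 ^+ (v * n) : R)%:C)%C * phi ((2 ^+ v : R) *: x)) \in schwartz.
Proof.
rewrite (_ : (fun _ => _) =
  (fun y => ((2 ^+ (v * n) : R)%:C)%C * phi ((2 ^+ v : R) *: y + 0))).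
  by apply: schwartz_affine; rewrite expf_neq0// pnatr_eq0.
by apply/funext => y; rewrite addr0.
Qed.

Definition dilate (v : nat) (phi : schwartz_space) :=
  SchwartzFun (dilate_subproof v phi).

Definition schwartz_seminorm (N : nat) (phi : schwartz_space) : R :=
  sup [set (1 + `|x|) ^+ N *
         Normc.normc (pderiv s (fun y => complex.Re (phi y)) x +i*
                      pderiv s (fun y => complex.Im (phi y)) x)%C
      | x in [set: 'rV[R]_n] & s in [set s : seq 'I_n | (size s <= N)%N]].

(* Continuity for the locally convex topology of the (increasing) family
   [schwartz_seminorm]. *)
Definition schwartz_continuous (f : schwartz_space -> R[i]) :=
  forall (phi : schwartz_space) (e : R), 0 < e ->
    exists (N : nat) (d : R), 0 < d /\
      forall psi : schwartz_space, schwartz_seminorm N (psi - phi) < d ->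
        Normc.normc (f psi - f phi) < e.

Record tempered := Tempered {
  tempered_fun :> {linear schwartz_space -> R[i]};
  tempered_continuous : schwartz_continuous tempered_fun }.

(* [(phi * f)(x) = f (phi (x - .))] *)
Definition conv (phi : schwartz_space) (f : tempered) (x : 'rV[R]_n) : R[i] :=
  f (reflect x phi).

End schwartz.

Section fourier.
Variables (R : realType) (n : nat).
Local Notation mu := (lebesgue_row R n).

Definition dot (x y : 'rV[R]_n) : R := \sum_(i < n) x 0 i * y 0 i.

Definition enorm (x : 'rV[R]_n) : R := Num.sqrt (dot x x).

Definition complex_integral (g : 'rV[R]_n -> R[i]) : R[i] :=
  (\int[mu]_x complex.Re (g x) +i* \int[mu]_x complex.Im (g x))%C.

Definition fourier (phi : 'rV[R]_n -> R[i]) (xi : 'rV[R]_n) : R[i] :=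
  ((2 * pi) `^ (- (n%:R / 2)))%:C%C *
  complex_integral (fun x => phi x * (cos (dot x xi) -i* sin (dot x xi))%C).

Definition fsupp (g : 'rV[R]_n -> R[i]) : set 'rV[R]_n :=
  closure [set xi | g xi != 0].

Definition admissible (Phi phi : schwartz_space R n) :=
  exists2 c : R, 0 < c &
    [/\ fsupp (fourier Phi) `<=` [set xi | enorm xi <= 2],
        forall xi, enorm xi <= 5 / 3 -> c <= Normc.normc (fourier Phi xi),
        fsupp (fourier phi) `<=`
          [set xi | enorm xi <= 2] `\` [set xi | enorm xi < 1 / 2] &
        forall xi, 3 / 5 <= enorm xi <= 5 / 3 ->
          c <= Normc.normc (fourier phi xi)].

End fourier.

Section exponents.
Variables (R : realType) (n : nat).
Implicit Types g p : 'rV[R]_n -> R.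

Definition ess_minus g : \bar R := ess_inf (lebesgue_row R n) (EFin \o g).
Definition ess_plus g : \bar R := ess_sup (lebesgue_row R n) (EFin \o g).

(* At [x = y] the left-hand side is 0 and the right-hand side is nonnegative,
   so the value given to [1 / 0] is immaterial. *)
Definition Clog_loc g := exists2 c : R, 0 < c &
  forall x y, `|g x - g y| <= c / ln (expR 1 + 1 / enorm (x - y)).

Definition Clog g := Clog_loc g /\
  exists (ginf : R), exists2 c : R, 0 < c &
    forall x, `|g x - ginf| <= c / ln (expR 1 + enorm x).

Definition P0 p :=
  measurable_fun [set: 'rV[R]_n] p /\ exists2 c : R, 0 < c & forall x, c <= p x.

Definition P0log p := P0 p /\ Clog (fun x => 1 / p x).

End exponents.

Section function_space.
Variables (R : realType) (n : nat).
Local Notation mu := (lebesgue_row R n).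
Implicit Types (p q alpha tau : 'rV[R]_n -> R).

Definition var_norm p (f : 'rV[R]_n -> \bar R) : \bar R :=
  ereal_inf [set m%:E | m in [set m : R | 0 < m /\
    (\int[mu]_x ((`|f x| * (m^-1)%:E) `^ p x) <= 1)%E]].

(* The norm in l^q of the sequence [u] restricted to the indices [>= k]. *)
Definition lq_norm (q : R) (k : nat) (u : nat -> R[i]) : \bar R :=
  ((\sum_(k <= v <oo) (Normc.normc (u v) `^ q)%:E) `^ q^-1)%E.

Definition mixed_norm p q (k : nat) (f : nat -> 'rV[R]_n -> R[i]) : \bar R :=
  var_norm p (fun x => lq_norm (q x) k (fun v => f v x)).

Definition dyadic_cube (v : int) (m : 'I_n -> int) : set 'rV[R]_n :=
  [set x : 'rV[R]_n | forall i, (m i)%:~R <= 2 ^ v * x 0 i < (m i)%:~R + 1].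

Definition volume (A : set 'rV[R]_n) : R := fine (mu A).

Definition lp_piece (Phi phi : schwartz_space R n) (v : nat) :=
  if v is 0 then Phi else dilate v phi.

Definition weighted (Phi phi : schwartz_space R n) alpha tau (f : tempered R n)
    (P : set 'rV[R]_n) (v : nat) (x : 'rV[R]_n) : R[i] :=
  ((2 `^ (v%:R * alpha x))%:C * conv (lp_piece Phi phi v) f x /
   (volume P `^ tau x)%:C * (\1_P x)%:C)%C.

(* A dyadic cube [P = dyadic_cube v m] has side length [2 ^- v], that is
   [v_P = v] and [v_P^+ = max v 0]. *)
Definition F_norm (Phi phi : schwartz_space R n) alpha tau p q
    (f : tempered R n) : \bar R :=
  ereal_sup [set mixed_norm p q `|Num.max v 0|%N
                   (weighted Phi phi alpha tau f (dyadic_cube v m))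
            | v in [set: int] & m in [set: 'I_n -> int]].

End function_space.

(* A quasi-normed space of elements of [T]; [qnorm] is allowed to be infinite
   outside of [carrier]. *)
Record qnspace (R : realType) (T : Type) := QNSpace {
  carrier : set T;
  qnorm : T -> \bar R }.

Definition embeds (R : realType) (T : Type) (A1 A2 : qnspace R T) :=
  carrier A1 `<=` carrier A2 /\
  exists2 c : R, 0 < c &
    forall f, carrier A1 f -> (qnorm A2 f <= c%:E * qnorm A1 f)%E.

Definition F_space (R : realType) (n : nat) (Phi phi : schwartz_space R n)
    (alpha tau p q : 'rV[R]_n -> R) : qnspace R (tempered R n) :=
  QNSpace [set f | (F_norm Phi phi alpha tau p q f < +oo)%E]
          (F_norm Phi phi alpha tau p q).

(* Main.v *)
Require Import Defs.
From mathcomp Require Import all_boot all_order all_algebra.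
From mathcomp Require Import all_classical all_reals all_analysis.
From mathcomp Require Import measurable_realfun ess_sup_inf complex.
Import Order.TTheory GRing.Theory Num.Theory.
Import numFieldNormedType.Exports.
Local Open Scope classical_set_scope.
Local Open Scope ring_scope.

(** Both embeddings come from a comparison of the weighted sequences at almost
    every fixed point [x], with a constant that depends neither on [x] nor on
    the dyadic cube. Such a comparison passes through [var_norm] and the
    supremum over cubes without change of constant, because [var_norm] is
    monotone and homogeneous ([var_norm_le_scale], [F_space_embeds]).

    For (i), the l^q norms decrease in q ([lq_norm_nonincreasing]), so the
    constant 1 works.

    For (ii), let [e > 0] be an almost everywhere lower bound of
    [alpha0 - alpha1]. Since only scales [v >= 0] occur, passing from [alpha0]
    to [alpha1] multiplies the v-th term by at most [(2 ^ - e) ^ v]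
    ([normc_weighted_le]). Each term with weight [alpha0] is bounded by the
    l^q0 norm of the sequence, so the l^q1 norm with weight [alpha1] is at most
    that norm times a convergent geometric l^q1 norm
    ([lq_norm_geometric_weight]). The latter is bounded uniformly in [x]
    because [q1] is bounded away from 0.

    The integral of a nonnegative function, measurable or not, is the supremum
    of the integrals of the simple functions below it. Monotonicity therefore
    requires no study of the regularity of the convolutions, and it extends to
    inequalities that fail on a null set ([ge0_ae_le_integral_nonmeasurable]). *)

(** * Monotonicity of the integral without measurability *)

Section integral_monotone.
Local Set Implicit Arguments.
Local Unset Strict Implicit.
Context {d : measure_display} {T : measurableType d} {R : realType}.
Variable mu : {measure set T -> \bar R}.
Import HBNNSimple.
Local Open Scope ereal_scope.

Lemma ge0_le_integral_nonmeasurable (f g : T -> \bar R) :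
  (forall x, 0 <= f x) -> (forall x, f x <= g x) ->
  \int[mu]_x f x <= \int[mu]_x g x.
Proof.
move=> f0 fg; have g0 x : 0 <= g x by exact: le_trans (f0 x) (fg x).
rewrite !ge0_integralTE//; apply: le_ereal_sup => _ [h hf <-].
by exists h => // x; exact: le_trans (hf x) (fg x).
Qed.

(** A simple function below [f] keeps its integral when it is cut to zero on the
    exceptional null set, and it then lies below [g] everywhere. *)
Lemma ge0_ae_le_integral_nonmeasurable (f g : T -> \bar R) :
  (forall x, 0 <= f x) -> (forall x, 0 <= g x) ->
  {ae mu, forall x, f x <= g x} -> \int[mu]_x f x <= \int[mu]_x g x.
Proof.
move=> f0 g0 [N [mN N0 fgN]].
rewrite [leLHS]ge0_integralTE//; apply: ge_ereal_sup => _ [h /= hf <-].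
rewrite -integralT_nnsfun (@ge0_negligible_integral _ _ _ mu setT N)//; last first.
- by move=> x _; rewrite lee_fin.
- exact/measurable_EFinP/measurable_funPT.
rewrite integral_mkcond; apply: ge0_le_integral_nonmeasurable => x.
- by rewrite /patch; case: ifP => // _; rewrite lee_fin.
- rewrite /patch; case: ifPn => //; rewrite inE => -[_ Nx].
  by apply: le_trans (hf x) _; apply: contrapT => /fgN.
Qed.

End integral_monotone.

(** * Sequence norms at a fixed point *)

Section lq.
Local Set Implicit Arguments.
Local Unset Strict Implicit.
Context {R : realType}.
Implicit Types (q r : R) (k v : nat) (u w : nat -> R[i]).

Lemma normc_ge0 (z : R[i]) : 0 <= Normc.normc z.
Proof. by case: z => a b; exact: sqrtr_ge0. Qed.

Lemma normc_real (a : R) : 0 <= a -> Normc.normc (a%:C)%C = a.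
Proof. by move=> a0; rewrite /= expr0n addr0 sqrtr_sqr ger0_norm. Qed.

Lemma powRrK (a q : R) : 0 < q -> 0 <= a -> (a `^ q) `^ q^-1 = a.
Proof. by move=> q0 a0; rewrite -powRrM mulfV ?gt_eqF// powRr1. Qed.

Lemma powR_lt1 (a q : R) : 0 < q -> 0 < a < 1 -> a `^ q < 1.
Proof.
move=> q0 /andP[a0 a1]; have -> : 1 = 1 `^ q :> R by rewrite powR1.
by apply: gt0_ltr_powR => //; rewrite nnegrE ltW.
Qed.

Lemma lq_norm_ge0 q k u : (0 <= lq_norm q k u)%E.
Proof. exact: poweR_ge0. Qed.

Lemma lq_sum_ge0 q k u :
  (0 <= \sum_(k <= v <oo) (Normc.normc (u v) `^ q)%:E)%E.
Proof. by apply: nneseries_ge0 => v _ _; rewrite lee_fin powR_ge0. Qed.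

Lemma lq_norm_le_of_partial q k u (M : R) : 0 < q -> 0 <= M ->
  (forall N, \sum_(k <= v < N) Normc.normc (u v) `^ q <= M `^ q) ->
  (lq_norm q k u <= M%:E)%E.
Proof.
move=> q0 M0 uM.
have -> : (M%:E = (M `^ q)%:E `^ q^-1)%E by rewrite poweR_EFin powRrK.
apply: gt0_ler_poweR; rewrite ?invr_ge0 ?(ltW q0)//.
- by rewrite in_itv/= leey lq_sum_ge0.
- by rewrite in_itv/= leey lee_fin powR_ge0.
apply: lime_le.
  by apply: is_cvg_nneseries => v _ _; rewrite lee_fin powR_ge0.
by apply: nearW => N; rewrite sumEFin lee_fin.
Qed.

Lemma lq_norm_coord_le q k u v : 0 < q -> (k <= v)%N ->
  ((Normc.normc (u v))%:E <= lq_norm q k u)%E.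
Proof.
move=> q0 kv.
rewrite -[X in (X%:E <= _)%E](powRrK q0) ?normc_ge0// -poweR_EFin.
apply: gt0_ler_poweR; rewrite ?invr_ge0 ?(ltW q0)//.
- by rewrite in_itv/= leey lee_fin powR_ge0.
- by rewrite in_itv/= leey lq_sum_ge0.
apply: le_trans (nneseries_lim_ge v.+1 _) => [|i _ _]; last first.
  by rewrite lee_fin powR_ge0.
by rewrite sumEFin lee_fin big_nat_recr//= lerDr sumr_ge0// => i _; exact: powR_ge0.
Qed.

(** With [S] the sum of the [b_v ^ q0], each [b_v] is at most [S ^ (1 / q0)], so
    [b_v ^ q1 <= S ^ (q1 / q0 - 1) * b_v ^ q0]; summing over [v] gives
    [S ^ (q1 / q0)], the q1-th power of the l^q0 norm. *)
Lemma lq_norm_nonincreasing q0 q1 k u : 0 < q0 -> q0 <= q1 ->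
  (lq_norm q1 k u <= lq_norm q0 k u)%E.
Proof.
move=> q00 q01; have q10 := lt_le_trans q00 q01.
have := lq_sum_ge0 q0 k u.
have coord v := @lq_norm_coord_le q0 k u v q00.
rewrite /lq_norm in coord *.
have := fun N => @nneseries_lim_ge R (fun v => (Normc.normc (u v) `^ q0)%:E)
  xpredT k N (fun _ _ _ => powR_ge0 _ _).
move: coord.
case: (\sum_(_ <= _ <oo) _)%E => [s||] //; last first.
  by move=> _ _ _; rewrite [leRHS]poweRyr ?invr_eq0 ?gt_eqF// leey.
rewrite poweR_EFin => coord part; rewrite lee_fin => s0.
apply: lq_norm_le_of_partial => // [|N]; first exact: powR_ge0.
(* [mulr_powRB1] also covers [s = 0], where [0 ^ (q1 / q0 - 1)] may be 1. *)
rewrite -powRrM mulrC -mulr_powRB1 ?divr_gt0//.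
have {part} := part N; rewrite sumEFin lee_fin => part.
rewrite [leRHS]mulrC; apply: le_trans (ler_wpM2l (powR_ge0 _ _) part).
rewrite mulr_sumr !big_nat; apply: ler_sum => v /andP[kv _].
have -> : q1 / q0 - 1 = q0^-1 * (q1 - q0).
  by rewrite mulrBr mulVf ?gt_eqF// mulrC.
have b0 := normc_ge0 (u v).
have [->|bN0] := eqVneq (Normc.normc (u v)) 0.
  by rewrite powR0 ?gt_eqF// mulr_ge0 ?powR_ge0.
rewrite -[in leLHS](subrK q0 q1) powRD; last by rewrite bN0 implybT.
rewrite ler_wpM2r ?powR_ge0// powRrM ge0_ler_powR ?nnegrE ?subr_ge0 ?powR_ge0//.
by rewrite -lee_fin; exact: coord.
Qed.

Lemma lq_norm_geometric_le q r k u (L : R) : 0 < q -> 0 < r < 1 -> 0 <= L ->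
  (forall v, (k <= v)%N -> Normc.normc (u v) <= L * r `^ v%:R) ->
  (lq_norm q k u <= (L * ((1 - r `^ q)^-1) `^ q^-1)%:E)%E.
Proof.
move=> q0 /andP[r0 r1] L0 uL.
have z0 : 0 < r `^ q by exact: powR_gt0.
have z1 : r `^ q < 1 by apply: powR_lt1; rewrite ?r0.
have K0 : 0 <= (1 - r `^ q)^-1 by rewrite invr_ge0 subr_ge0 ltW.
apply: lq_norm_le_of_partial => // [|N]; first by rewrite mulr_ge0 ?powR_ge0.
rewrite powRM ?powR_ge0// -powRrM mulVf ?gt_eqF// powRr1//.
have zn : `|r `^ q| < 1 by rewrite ger0_norm ?ltW.
have geo := @geometric_le_lim R N (L `^ q) (r `^ q) (powR_ge0 _ _) z0 zn.
apply: le_trans geo.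
rewrite /series/=.
apply: (@le_trans _ _ (\sum_(k <= v < N) L `^ q * (r `^ q) ^+ v)).
  rewrite !big_nat; apply: ler_sum => v /andP[kv _].
  rewrite -powR_mulrn ?powR_ge0// powRAC -powRM ?powR_ge0//.
  rewrite ge0_ler_powR ?nnegrE ?uL ?(ltW q0) ?normc_ge0 ?mulr_ge0 ?powR_ge0//.
have [kN|Nk] := leqP k N; last first.
  rewrite [leLHS]big_geq; last exact: ltnW.
  apply: sumr_ge0 => i _.
  by rewrite mulr_ge0 ?powR_ge0 ?exprn_ge0 ?(ltW z0).
rewrite [leRHS](@big_cat_nat _ _ _ k)//= lerDr sumr_ge0// => i _.
by rewrite mulr_ge0 ?powR_ge0 ?exprn_ge0 ?(ltW z0).
Qed.

(** The bound replaces [q1] by its lower bound [c] in the geometric constant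
    [(1 / (1 - r ^ q1)) ^ (1 / q1)], so that it can serve for all the values of
    a variable exponent. *)
Lemma lq_norm_geometric_weight c q0 q1 r k u w :
  0 < q0 -> 0 < c -> c <= q1 -> 0 < r < 1 ->
  (forall v, Normc.normc (w v) <= r `^ v%:R * Normc.normc (u v)) ->
  (lq_norm q1 k w <= (((1 - r `^ c)^-1) `^ c^-1)%:E * lq_norm q0 k u)%E.
Proof.
move=> q00 c0 cq1 r01 wu; have q10 := lt_le_trans c0 cq1.
have /andP[r0 r1] := r01.
have zc1 : r `^ c < 1 by exact: powR_lt1.
have K0 : 0 < ((1 - r `^ c)^-1) `^ c^-1.
  by rewrite powR_gt0// invr_gt0 subr_gt0.
have := lq_norm_ge0 q0 k u.
have := fun v => @lq_norm_coord_le q0 k u v q00.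
case: (lq_norm q0 k u) => [L||] //; last by move=> _ _; rewrite gt0_muley ?lte_fin// leey.
move=> uL; rewrite lee_fin => L0.
apply: le_trans (@lq_norm_geometric_le q1 r k w L q10 r01 L0 _) _.
  move=> v kv; apply: le_trans (wu v) _; rewrite mulrC ler_wpM2r ?powR_ge0//.
  by rewrite -lee_fin; exact: uL.
rewrite -EFinM lee_fin mulrC ler_wpM2r//.
have zq : r `^ q1 <= r `^ c by rewrite ger_powR// r0 ltW.
have zq1 := le_lt_trans zq zc1.
apply: (@le_trans _ _ ((1 - r `^ c)^-1 `^ q1^-1)).
  apply: ge0_ler_powR.
  - by rewrite invr_ge0 ltW.
  - by rewrite nnegrE invr_ge0 subr_ge0 ltW.
  - by rewrite nnegrE invr_ge0 subr_ge0 ltW.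
  - by rewrite lef_pV2 ?posrE ?subr_gt0// lerD2l lerN2.
(* The base is at least 1, so the power increases with the exponent. *)
rewrite ler_powR ?lef_pV2 ?posrE//.
by rewrite invr_ge1 ?unitfE ?gt_eqF ?subr_gt0// lerBlDr lerDl powR_ge0.
Qed.

End lq.

(** * From pointwise bounds to embeddings *)

Section spaces.
Local Set Implicit Arguments.
Local Unset Strict Implicit.
Context {R : realType} {n : nat}.
Local Notation mu := (lebesgue_row R n).
Implicit Types (p q alpha tau : 'rV[R]_n -> R).

(** If [m] is admissible in the infimum that defines the norm of [g], then
    [C * m] is admissible for [f]. *)
Lemma var_norm_le_scale p (f g : 'rV[R]_n -> \bar R) (C : R) :
  (forall x, 0 <= p x) -> 0 < C ->
  {ae mu, forall x, (`|f x| <= C%:E * `|g x|)%E} ->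
  (var_norm p f <= C%:E * var_norm p g)%E.
Proof.
move=> p0 C0 fg; rewrite -lee_pdivrMl//.
apply: le_ereal_inf_tmp => _ [m [m0 gm] <-].
rewrite lee_pdivrMl// -EFinM; apply: ereal_inf_lbound.
exists (C * m) => //; split; first exact: mulr_gt0.
apply: le_trans gm; apply: ge0_ae_le_integral_nonmeasurable => [x|x|].
- exact: poweR_ge0.
- exact: poweR_ge0.
apply: filterS fg => x fgx; apply: gt0_ler_poweR => //.
- by rewrite in_itv/= leey mule_ge0// lee_fin invr_ge0 mulr_ge0 ?ltW.
- by rewrite in_itv/= leey mule_ge0// lee_fin invr_ge0 ltW.
apply: (@le_trans _ _ (C%:E * `|g x| * ((C * m)^-1)%:E)%E).
  by rewrite lee_wpmul2r// lee_fin invr_ge0 mulr_ge0 ?ltW.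
by rewrite (muleC C%:E) -muleA -EFinM invfM mulrA mulfV ?gt_eqF// mul1r.
Qed.

(** The hypothesis puts the distribution, the set and the first index inside the
    almost everywhere quantifier: one null set serves for all of them. *)
Lemma F_space_embeds (Phi phi : schwartz_space R n)
    alpha0 alpha1 tau p q0 q1 (C : R) :
  (forall x, 0 <= p x) -> 0 < C ->
  {ae mu, forall x, forall f P k,
    (lq_norm (q1 x) k (fun v => weighted Phi phi alpha1 tau f P v x) <=
     C%:E * lq_norm (q0 x) k (fun v => weighted Phi phi alpha0 tau f P v x))%E} ->
  embeds (F_space Phi phi alpha0 tau p q0) (F_space Phi phi alpha1 tau p q1).
Proof.
move=> p0 C0 le_lq.
have le_F f : (F_norm Phi phi alpha1 tau p q1 f <=
    C%:E * F_norm Phi phi alpha0 tau p q0 f)%E.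
  apply: ge_ereal_sup => _ [v _ [m _ <-]].
  apply: (@le_trans _ _ (C%:E * mixed_norm p q0 `|Num.max v 0|%N
      (weighted Phi phi alpha0 tau f (dyadic_cube v m)))%E).
    apply: var_norm_le_scale => //; apply: filterS le_lq => x le_x.
    by rewrite !gee0_abs ?lq_norm_ge0.
  rewrite lee_wpmul2l ?lee_fin ?(ltW C0)//; apply: ereal_sup_ubound.
  by exists v => //; exists m.
split; last by exists C => // f _; exact: le_F.
move=> f /= ffin; apply: le_lt_trans (le_F f) _.
by rewrite lte_mul_pinfty ?lee_fin ?(ltW C0).
Qed.

Lemma normc_weighted_le (Phi phi : schwartz_space R n) alpha0 alpha1 tau
    (f : tempered R n) P (e : R) v x : e <= alpha0 x - alpha1 x ->
  Normc.normc (weighted Phi phi alpha1 tau f P v x) <=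
  (2 `^ (- e)) `^ v%:R * Normc.normc (weighted Phi phi alpha0 tau f P v x).
Proof.
move=> ex; rewrite /weighted !Normc.normcM !normc_real ?powR_ge0// !mulrA.
do 3 rewrite ler_wpM2r ?normc_ge0//.
rewrite -powRrM -powRD; last by rewrite pnatr_eq0 implybT.
rewrite ler_powR ?ler1n// (mulrC (- e)) -mulrDr ler_wpM2l//.
by rewrite addrC lerBrDr addrC -lerBrDr.
Qed.

Lemma ess_minus_gt0 (g : 'rV[R]_n -> R) : (0 < ess_minus g)%E ->
  exists2 e : R, 0 < e & {ae mu, forall x, e <= g x}.
Proof.
have ae_ge e : (e%:E <= ess_minus g)%E -> {ae mu, forall x, e <= g x}.
  by move=> /ess_infP; apply: filterS => x; rewrite lee_fin.
move: ae_ge; case: (ess_minus g) => [e||] // ae_ge e0.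
- by exists e => //; exact: ae_ge.
(* An infinite essential infimum leaves the choice of the bound free. *)
- by exists 1 => //; apply: ae_ge; rewrite leey.
Qed.

End spaces.

Theorem theorem6 (R : realType) (n : nat) (n_gt0 : (0 < n)%N)
    (Phi phi : schwartz_space R n) (adm : admissible Phi phi)
    (alpha alpha0 alpha1 tau p q0 q1 : 'rV[R]_n -> R)
    (alpha_log : Clog_loc alpha) (alpha0_log : Clog_loc alpha0)
    (alpha1_log : Clog_loc alpha1) (tau_log : Clog_loc tau)
    (tau_gt0 : (0 < ess_minus tau)%E)
    (p_log : P0log p) (q0_log : P0log q0) (q1_log : P0log q1)
    (p_fin : (ess_plus p < +oo)%E) (q0_fin : (ess_plus q0 < +oo)%E)
    (q1_fin : (ess_plus q1 < +oo)%E) :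
  ((forall x, q0 x <= q1 x) ->
     embeds (F_space Phi phi alpha tau p q0) (F_space Phi phi alpha tau p q1)) /\
  ((0 < ess_minus (fun x => (alpha0 x - alpha1 x)%R))%E ->
     embeds (F_space Phi phi alpha0 tau p q0)
            (F_space Phi phi alpha1 tau p q1)).
Proof.
have [[_ [cp cp0 cp_le]] _] := p_log.
have [[_ [c0 c00 c0_le]] _] := q0_log.
have [[_ [c1 c10 c1_le]] _] := q1_log.
have p0 x : 0 <= p x by exact: le_trans (ltW cp0) (cp_le x).
have q00 x : 0 < q0 x by exact: lt_le_trans c00 (c0_le x).
split=> [q01|/ess_minus_gt0[e e0 e_le]].
  apply: (@F_space_embeds R n _ _ _ _ _ _ _ _ 1) => //.
  apply: aeW => x f P k; rewrite mul1e.
  exact: lq_norm_nonincreasing.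
have r01 : 0 < (2 : R) `^ (- e) < 1.
  rewrite powR_gt0//= powRN invf_lt1 ?powR_gt0//.
  by rewrite /powR pnatr_eq0 /= expR_gt1 mulr_gt0 ?ln_gt0 ?ltr1n.
apply: (@F_space_embeds R n _ _ _ _ _ _ _ _
  (((1 - (2 `^ (- e)) `^ c1)^-1) `^ c1^-1)) => //.
  by rewrite powR_gt0// invr_gt0 subr_gt0; exact: powR_lt1.
apply: filterS e_le => x ex f P k.
apply: lq_norm_geometric_weight => //.
by move=> v; exact: normc_weighted_le.
Qed.
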